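(* Let $n\geq 2$. Then $$\mathcal{M}(\mathbb{A}_2;\mathbb{A}_n)=\{(a,b)\in V_{2^n-1,2} : a \text{ alternates strongly with } b\},$$ where the equality means that the map $\varphi\mapsto(\varphi(e_1),\varphi(e_2))$ is a bijection from the left-hand set onto the right-hand set. In particular, under this identification, $$\mathrm{Aut}(\mathbb{A}_2)=\mathcal{M}(\mathbb{A}_2;\mathbb{A}_2)=V_{3,2}=SO(3)$$ (where $V_{3,2}$ is identified in the standard way with $SO(3)$, an orthonormal pair $(u,v)$ in $\mathbb{R}^3$ corresponding to the matrix with columns $u,v,u\times v$), and $$\mathcal{M}(\mathbb{A}_2;\mathbb{A}_3)=V_{7,2}.$$
   Context: The Cayley-Dickson algebras $\mathbb{A}_n=\mathbb{R}^{2^n}$ ($n\geq 0$) are the real algebras defined recursively by $\mathbb{A}_0=\mathbb{R}$ with trivial conjugation $\overline{x}=x$, and $\mathbb{A}_{n+1}=\mathbb{A}_n\times\mathbb{A}_n$ with product $(a,b)(x,y)=(ax-\overline{y}b,\;ya+b\overline{x})$ and conjugation $\overline{(x,y)}=(\overline{x},-y)$. The canonical basis of $\mathbb{A}_n=\mathbb{R}^{2^n}$ is denoted $e_0,e_1,\ldots,e_{2^n-1}$; recursively, the basis of $\mathbb{A}_{n+1}$ is $(e_0,0),\ldots,(e_{2^n-1},0),(0,e_0),\ldots,(0,e_{2^n-1})$ in this order. The element $e_0$ is the unit. The norm $\|\cdot\|$ and inner product (hence $\perp$) are the standard Euclidean ones on $\mathbb{R}^{2^n}$. $\mathrm{Im}(\mathbb{A}_n)=\{e_0\}^\perp\cong\mathbb{R}^{2^n-1}$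 is the subspace of pure elements. For $1\leq m\leq n$, an algebra monomorphism $\varphi:\mathbb{A}_m\to\mathbb{A}_n$ is an injective $\mathbb{R}$-linear map with $\varphi(e_0)=e_0$ and $\varphi(xy)=\varphi(x)\varphi(y)$ for all $x,y\in\mathbb{A}_m$. $\mathcal{M}(\mathbb{A}_m;\mathbb{A}_n)$ denotes the set of all algebra monomorphisms $\mathbb{A}_m\to\mathbb{A}_n$; for $m=n$ it is the automorphism group $\mathrm{Aut}(\mathbb{A}_n)$. The associator is $(x,y,z)=(xy)z-x(yz)$. For $a,b\in\mathbb{A}_n$, $a$ alternates strongly with $b$ if $(a,a,b)=0$ and $(a,b,b)=0$. The Stiefel manifold $V_{2^n-1,2}$ is identified with $\{(a,b)\in\mathrm{Im}(\mathbb{A}_n)\times\mathrm{Im}(\mathbb{A}_n) : a\perp b,\ \|a\|=\|b\|=1\}$. *)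

(* Defs.v *)
From HB Require Import structures.
From mathcomp Require Import all_boot all_order all_algebra.
From mathcomp Require Import boolp classical_sets functions reals.

Set Implicit Arguments.
Unset Strict Implicit.
Unset Printing Implicit Defensive.

Import Order.TTheory GRing.Theory Num.Theory.

Local Open Scope classical_set_scope.
Local Open Scope ring_scope.

Section CayleyDickson.
Variable R : realType.

(* MathComp has no structure of nonassociative algebra: CD n carries the
   R-module structure, and the product is the separate function cdmul. *)
Fixpoint CD (n : nat) : lmodType R :=
  if n is m.+1 then (CD m * CD m)%type else R^o.

Fixpoint cdconj (n : nat) : CD n -> CD n :=
  match n with
  | 0 => fun x => x
  | m.+1 => fun x : CD m * CD m => (cdconj x.1, - x.2)
  end.

Fixpoint cdmul (n : nat) : CD n -> CD n -> CD n :=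
  match n with
  | 0 => fun x y : R => x * y
  | m.+1 => fun p q : CD m * CD m =>
      let: (a, b) := p in let: (x, y) := q in
      (cdmul a x - cdmul (cdconj y) b, cdmul y a + cdmul b (cdconj x))
  end.

(* The i-th canonical basis vector, for i < 2 ^ n (it is 0 for larger i). *)
Fixpoint cde (n i : nat) : CD n :=
  match n with
  | 0 => (i == 0%N)%:R : R
  | m.+1 =>
      (if (i < 2 ^ m)%N then (cde m i, 0) else (0, cde m (i - 2 ^ m)%N))
      : CD m * CD m
  end.

(* The i-th coordinate under the identification of CD n with R^(2 ^ n), for
   i < 2 ^ n; see cd_coordE. *)
Fixpoint cdcoord (n : nat) : CD n -> nat -> R :=
  match n with
  | 0 => fun (x : R) _ => x
  | m.+1 => fun (x : CD m * CD m) i =>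
      if (i < 2 ^ m)%N then cdcoord x.1 i else cdcoord x.2 (i - 2 ^ m)%N
  end.

Definition cddot (n : nat) (x y : CD n) : R :=
  \sum_(i < 2 ^ n) cdcoord x i * cdcoord y i.

Definition cdnorm (n : nat) (x : CD n) : R := Num.sqrt (cddot x x).

Definition cdIm (n : nat) : set (CD n) := [set x | cddot x (cde n 0) = 0].

Definition associator (n : nat) (x y z : CD n) : CD n :=
  cdmul (cdmul x y) z - cdmul x (cdmul y z).

Definition alternates_strongly (n : nat) (a b : CD n) : Prop :=
  associator a a b = 0 /\ associator a b b = 0.

Definition algebra_hom (m n : nat) (phi : CD m -> CD n) : Prop :=
  [/\ linear phi,
      phi (cde m 0) = cde n 0 &
      forall x y, phi (cdmul x y) = cdmul (phi x) (phi y)].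

Definition Mono (m n : nat) : set (CD m -> CD n) :=
  [set phi | algebra_hom phi /\ injective phi].

Definition Aut (n : nat) : set (CD n -> CD n) :=
  [set phi | algebra_hom phi /\ bijective phi].

(* V_(2 ^ n - 1, 2), as the orthonormal pairs of pure elements. *)
Definition Stiefel2 (n : nat) : set (CD n * CD n) :=
  [set p | [/\ cdIm p.1, cdIm p.2, cddot p.1 p.2 = 0,
               cdnorm p.1 = 1 & cdnorm p.2 = 1]].

Definition ev12 (n : nat) (phi : CD 2 -> CD n) : CD n * CD n :=
  (phi (cde 2 1), phi (cde 2 2)).

Definition SO3 : set 'M[R]_3 := [set A | A^T *m A = 1%:M /\ \det A = 1].

(* Row indices are in 'I_3, where + is addition modulo 3. *)
Definition cross (u v : 'cV[R]_3) : 'cV[R]_3 :=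
  \col_i (u (i + 1) 0 * v (i + 2) 0 - u (i + 2) 0 * v (i + 1) 0).

(* The identification of cdIm 2 with R^3 drops the coordinate along e_0. *)
Definition Im2_col (x : CD 2) : 'cV[R]_3 := \col_(i < 3) cdcoord x i.+1.

Definition frame_mx (p : CD 2 * CD 2) : 'M[R]_3 :=
  let u := Im2_col p.1 in let v := Im2_col p.2 in
  row_mx u (row_mx v (cross u v)).

Lemma cdcoordE (n i j : nat) :
  (i < 2 ^ n)%N -> (j < 2 ^ n)%N -> cdcoord (cde n i) j = (i == j)%:R.
Proof.
have z m k : cdcoord (0 : CD m) k = 0.
  by elim: m k => [|m IH] k //=; case: ifP => _; apply: IH.
elim: n i j => [|n IH] i j /=; first by case: i j => [|[]] // [|[]].
rewrite expnS mul2n -addnn => Hi Hj.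
case: (ltnP i (2 ^ n)) => Li; case: (ltnP j (2 ^ n)) => Lj /=.
- exact: IH.
- by rewrite z (ltn_eqF (leq_trans Li Lj)).
- by rewrite z eq_sym (ltn_eqF (leq_trans Lj Li)).
rewrite IH ?ltn_subLR //; congr (nat_of_bool _)%:R.
by rewrite -(eqn_add2r (2 ^ n)) !subnK.
Qed.

Lemma cd_coordE (n : nat) (x : CD n) :
  x = \sum_(i < 2 ^ n) cdcoord x i *: cde n i.
Proof.
elim: n x => [|n IH] x /=.
  by rewrite big_ord_recl big_ord0 addr0 /= [RHS]mulr1.
rewrite -(big_mkord predT (fun i => (if (i < 2 ^ n)%N then cdcoord x.1 i
  else cdcoord x.2 (i - 2 ^ n)%N) *: ((if (i < 2 ^ n)%N then (cde n i, 0)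
  else (0, cde n (i - 2 ^ n)%N)) : CD n * CD n))).
rewrite expnS mul2n -addnn big_mkord big_split_ord /=.
have {1}->: x = ((x.1, 0) + (0, x.2) : CD n * CD n).
  by case: x => a b; rewrite -[RHS]/(a + 0, 0 + b) addr0 add0r.
congr (_ + _).
- under eq_bigr => i _ do rewrite ltn_ord.
  rewrite {1}(IH x.1); elim/big_rec2: _ => // i y1 y2 _ <-.
  by rewrite -[RHS]/(_, _ *: 0 + 0) scaler0 addr0.
- under eq_bigr => i _ do rewrite ltnNge leq_addr addKn /=.
  rewrite {1}(IH x.2); elim/big_rec2: _ => // i y1 y2 _ <-.
  by rewrite -[RHS]/(_ *: 0 + 0, _) scaler0 addr0.
Qed.

End CayleyDickson.

Arguments cde R n i : clear implicits.
Arguments Mono R m n : clear implicits.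
Arguments Aut R n : clear implicits.
Arguments Stiefel2 R n : clear implicits.
Arguments SO3 R : clear implicits.

(* Main.v *)
Require Import Defs.
From HB Require Import structures.
From mathcomp Require Import all_boot all_order all_algebra.
From mathcomp Require Import boolp classical_sets functions reals.
From mathcomp Require Import ring lra.

Import Order.TTheory GRing.Theory Num.Theory.
Local Open Scope classical_set_scope.
Local Open Scope ring_scope.

(** The product of a Cayley-Dickson algebra, though nonassociative, satisfies
    <ax, y> = <x, a^* y>, <xa, y> = <x, y a^*> and x^* x = x x^* = |x|^2 e_0.
    Hence for orthonormal pure a, b one has a^2 = b^2 = - e_0 and ba = - ab,
    and ab is pure and orthogonal to a and b.  If (a, a, b) = (a, b, b) = 0,
    then moreover |ab| = 1, a(ab) = - b and (ab)b = - a, so that e_0, a, b, ab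
    multiply like the quaternion basis.  Conversely, a^2 = - e_0 forces a to be
    pure of norm 1, so a morphism from A_2 maps e_1, e_2 to an orthonormal pure
    pair, which alternates strongly because A_2 is associative. *)

Section CayleyDicksonTheory.
Set Implicit Arguments.
Unset Strict Implicit.
Variable R : realType.

Local Notation "x # i" :=
  (cdcoord x i) (at level 8, i at level 0, format "x # i").

(** * Coordinates *)

Lemma cdcoord0 n i : cdcoord (0 : CD R n) i = 0.
Proof. by elim: n i => [|n IH] i //=; case: ifP => _; apply: IH. Qed.

Lemma cdcoordD n (x y : CD R n) i :
  cdcoord (x + y) i = cdcoord x i + cdcoord y i.
Proof. by elim: n x y i => [|n IH] x y i //=; case: ifP => _; apply: IH. Qed.

Lemma cdcoordZ n (k : R) (x : CD R n) i : cdcoord (k *: x) i = k * cdcoord x i.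
Proof. by elim: n x i => [|n IH] x i //=; case: ifP => _; apply: IH. Qed.

Lemma cdcoordN n (x : CD R n) i : cdcoord (- x) i = - cdcoord x i.
Proof. by rewrite -scaleN1r cdcoordZ mulN1r. Qed.

Definition cdcoord_linE := (cdcoordD, cdcoordN, cdcoordZ, cdcoord0).

Lemma cdcoord_inj n (x y : CD R n) : cdcoord x =1 cdcoord y -> x = y.
Proof.
move=> Exy; rewrite (cd_coordE x) (cd_coordE y).
by apply: eq_bigr => i _; rewrite Exy.
Qed.

(** Settles identities of the module structure coordinate by coordinate: nonassociative products
    stay atoms, and [ring] works on their real coordinates. *)
Ltac cdlin := apply: cdcoord_inj => ?; rewrite !cdcoord_linE; ring.

(** * Conjugation, product and unit, by induction on the doubling *)

Lemma cd_eqS n (x y : CD R n.+1) : x.1 = y.1 -> x.2 = y.2 -> x = y.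
Proof. by case: x y => [a b] [c d] /= -> ->. Qed.

Lemma fstD n (x y : CD R n.+1) : (x + y).1 = x.1 + y.1. Proof. by []. Qed.
Lemma sndD n (x y : CD R n.+1) : (x + y).2 = x.2 + y.2. Proof. by []. Qed.
Lemma fstN n (x : CD R n.+1) : (- x).1 = - x.1. Proof. by []. Qed.
Lemma sndN n (x : CD R n.+1) : (- x).2 = - x.2. Proof. by []. Qed.
Lemma fstZ n (k : R) (x : CD R n.+1) : (k *: x).1 = k *: x.1. Proof. by []. Qed.
Lemma sndZ n (k : R) (x : CD R n.+1) : (k *: x).2 = k *: x.2. Proof. by []. Qed.

Lemma cdmul_fst n (x y : CD R n.+1) :
  (cdmul x y).1 = cdmul x.1 y.1 - cdmul (cdconj y.2) x.2.
Proof. by case: x y => [a b] [c d]. Qed.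

Lemma cdmul_snd n (x y : CD R n.+1) :
  (cdmul x y).2 = cdmul y.2 x.1 + cdmul x.2 (cdconj y.1).
Proof. by case: x y => [a b] [c d]. Qed.

Lemma cdconj_fst n (x : CD R n.+1) : (cdconj x).1 = cdconj x.1.
Proof. by []. Qed.

Lemma cdconj_snd n (x : CD R n.+1) : (cdconj x).2 = - x.2.
Proof. by []. Qed.

Definition pairE := (cdmul_fst, cdmul_snd, cdconj_fst, cdconj_snd,
  fstD, sndD, fstN, sndN, fstZ, sndZ).

Lemma cdconjD n (x y : CD R n) : cdconj (x + y) = cdconj x + cdconj y.
Proof.
elim: n x y => [|n IH] x y //.
by apply: cd_eqS; rewrite !pairE ?IH //; cdlin.
Qed.

Lemma cdconjZ n (k : R) (x : CD R n) : cdconj (k *: x) = k *: cdconj x.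
Proof.
elim: n x => [|n IH] x //.
by apply: cd_eqS; rewrite !pairE ?IH //; cdlin.
Qed.

Lemma cdconjN n (x : CD R n) : cdconj (- x) = - cdconj x.
Proof. by rewrite -scaleN1r cdconjZ scaleN1r. Qed.

Lemma cdconj0 n : cdconj (0 : CD R n) = 0.
Proof. by rewrite -[0](scale0r (0 : CD R n)) cdconjZ !scale0r. Qed.

Lemma cdconjK n : involutive (@cdconj R n).
Proof.
elim: n => [|n IH] x //.
by apply: cd_eqS; rewrite !pairE ?IH ?opprK.
Qed.

(** Doubling swaps the order of some factors, so each one-sided linearity at level [n.+1] uses both
    at level [n]; hence the joint induction. *)
Lemma cdmul_bilin n :
  (forall k (x y z : CD R n), cdmul (k *: x + y) z = k *: cdmul x z + cdmul y z)
  /\ (forall k (x y z : CD R n),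
        cdmul z (k *: x + y) = k *: cdmul z x + cdmul z y).
Proof.
elim: n => [|n [IHl IHr]].
  split=> k x y z.
    by change ((k * x + y) * z = k * (x * z) + y * z :> R); ring.
  by change (z * (k * x + y) = k * (z * x) + z * y :> R); ring.
by split=> k x y z; apply: cd_eqS;
  rewrite !pairE ?cdconjD ?cdconjZ ?(IHl, IHr) -?scaleN1r ?(IHl, IHr); cdlin.
Qed.

Lemma cdmul0l n (x : CD R n) : cdmul 0 x = 0.
Proof.
have := (cdmul_bilin n).1 1 0 0 x; rewrite scaler0 addr0 scale1r.
by move/eqP; rewrite -subr_eq0 opprD addNKr oppr_eq0 => /eqP.
Qed.

Lemma cdmul0r n (x : CD R n) : cdmul x 0 = 0.
Proof.
have := (cdmul_bilin n).2 1 0 0 x; rewrite scaler0 addr0 scale1r.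
by move/eqP; rewrite -subr_eq0 opprD addNKr oppr_eq0 => /eqP.
Qed.

Lemma cdmulZl n (k : R) (x y : CD R n) : cdmul (k *: x) y = k *: cdmul x y.
Proof. by rewrite -[k *: x]addr0 (cdmul_bilin n).1 cdmul0l addr0. Qed.

Lemma cdmulZr n (k : R) (x y : CD R n) : cdmul x (k *: y) = k *: cdmul x y.
Proof. by rewrite -[k *: y]addr0 (cdmul_bilin n).2 cdmul0r addr0. Qed.

Lemma cdmulDl n (x y z : CD R n) : cdmul (x + y) z = cdmul x z + cdmul y z.
Proof. by rewrite -[x]scale1r (cdmul_bilin n).1 !scale1r. Qed.

Lemma cdmulDr n (x y z : CD R n) : cdmul x (y + z) = cdmul x y + cdmul x z.
Proof. by rewrite -[y]scale1r (cdmul_bilin n).2 !scale1r. Qed.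

Lemma cdmulNl n (x y : CD R n) : cdmul (- x) y = - cdmul x y.
Proof. by rewrite -scaleN1r cdmulZl scaleN1r. Qed.

Lemma cdmulNr n (x y : CD R n) : cdmul x (- y) = - cdmul x y.
Proof. by rewrite -scaleN1r cdmulZr scaleN1r. Qed.

Definition cdmul_linE :=
  (cdmulDl, cdmulDr, cdmulNl, cdmulNr, cdmulZl, cdmulZr, cdmul0l, cdmul0r).

Lemma cde0_fst n : (cde R n.+1 0).1 = cde R n 0.
Proof. by rewrite /= expn_gt0. Qed.

Lemma cde0_snd n : (cde R n.+1 0).2 = 0.
Proof. by rewrite /= expn_gt0. Qed.

Lemma cdconj_e0 n : cdconj (cde R n 0) = cde R n 0.
Proof.
elim: n => [|n IH] //.
by apply: cd_eqS; rewrite !pairE ?cde0_fst ?cde0_snd ?oppr0.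
Qed.

(** Joint induction again: the second component of [cdmul (cde R n.+1 0) x] is
    [cdmul x.2 (cde R n 0)], where the unit acts on the right. *)
Lemma cdmul1 n : left_id (cde R n 0) (@cdmul R n)
                /\ right_id (cde R n 0) (@cdmul R n).
Proof.
elim: n => [|n [IHl IHr]]; first by split=> x; [exact: mul1r | exact: mulr1].
by split=> x; apply: cd_eqS;
  rewrite !pairE ?cde0_fst ?cde0_snd ?cdconj_e0
    ?cdconj0 ?cdmul_linE ?IHl ?IHr ?(subr0, addr0, add0r).
Qed.

Lemma cdmulE0l n : left_id (cde R n 0) (@cdmul R n).
Proof. exact: (cdmul1 n).1. Qed.

Lemma cdmulE0r n : right_id (cde R n 0) (@cdmul R n).
Proof. exact: (cdmul1 n).2. Qed.

Lemma cdconjM n (x y : CD R n) :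
  cdconj (cdmul x y) = cdmul (cdconj y) (cdconj x).
Proof.
elim: n x y => [|n IH] x y; first exact: mulrC.
by apply: cd_eqS;
  rewrite !pairE ?cdconjD ?cdconjN ?IH ?cdconjK ?cdmul_linE; cdlin.
Qed.

(** * Euclidean inner product and adjoints of multiplications *)

Lemma cddotS n (x y : CD R n.+1) :
  cddot x y = cddot x.1 y.1 + cddot x.2 y.2.
Proof.
rewrite /cddot -(big_mkord predT (fun i => cdcoord x i * cdcoord y i)).
rewrite expnS mul2n -addnn big_mkord big_split_ord; congr (_ + _).
  by apply: eq_bigr => i _; rewrite /= ltn_ord.
by apply: eq_bigr => i _; rewrite /= ltnNge leq_addr addKn.
Qed.

Lemma cddot0E (x y : CD R 0) : cddot x y = (x : R) * y.
Proof. by rewrite /cddot big_ord_recl big_ord0 addr0. Qed.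

Lemma cddotC n (x y : CD R n) : cddot x y = cddot y x.
Proof. by apply: eq_bigr => i _; rewrite mulrC. Qed.

Lemma cddotDl n (x y z : CD R n) : cddot (x + y) z = cddot x z + cddot y z.
Proof.
by rewrite -big_split; apply: eq_bigr => i _; rewrite cdcoordD mulrDl.
Qed.

Lemma cddotZl n (k : R) (x y : CD R n) : cddot (k *: x) y = k * cddot x y.
Proof.
by rewrite mulr_sumr; apply: eq_bigr => i _; rewrite cdcoordZ mulrA.
Qed.

Lemma cddotNl n (x y : CD R n) : cddot (- x) y = - cddot x y.
Proof. by rewrite -scaleN1r cddotZl mulN1r. Qed.

Lemma cddotDr n (x y z : CD R n) : cddot x (y + z) = cddot x y + cddot x z.
Proof. by rewrite cddotC cddotDl !(cddotC x). Qed.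

Lemma cddotZr n (k : R) (x y : CD R n) : cddot x (k *: y) = k * cddot x y.
Proof. by rewrite cddotC cddotZl cddotC. Qed.

Lemma cddotNr n (x y : CD R n) : cddot x (- y) = - cddot x y.
Proof. by rewrite cddotC cddotNl cddotC. Qed.

Definition cddot_linE := (cddotDl, cddotDr, cddotNl, cddotNr, cddotZl, cddotZr).

Lemma cddot_ge0 n (x : CD R n) : 0 <= cddot x x.
Proof. by apply: sumr_ge0 => i _; rewrite -expr2 sqr_ge0. Qed.

Lemma cddot_eq0 n (x : CD R n) : cddot x x = 0 -> x = 0.
Proof.
move/psumr_eq0P => /= x0; rewrite (cd_coordE x) big1 // => i _.
have /eqP := x0 (fun j _ => sqr_ge0 (cdcoord x j)) i isT.
by rewrite mulf_eq0 orbb => /eqP->; rewrite scale0r.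
Qed.

Lemma cddot_e0 n : cddot (cde R n 0) (cde R n 0) = 1.
Proof.
elim: n => [|n IH]; first by rewrite cddot0E mulr1.
rewrite cddotS !cde0_fst !cde0_snd IH.
by rewrite -[X in cddot X](scale0r (0 : CD R n)) cddotZl mul0r addr0.
Qed.

Lemma cddot_conj n (x y : CD R n) : cddot (cdconj x) y = cddot x (cdconj y).
Proof.
elim: n x y => [|n IH] x y //.
by rewrite !cddotS !pairE IH cddotNl cddotNr.
Qed.

(** Expanding over the doubling gives four terms on each side. They match in pairs by the
    adjunctions one level down, left and right ones mixed. *)
Lemma cddot_mul_adj n :
  (forall a x y : CD R n, cddot (cdmul a x) y = cddot x (cdmul (cdconj a) y))
  /\ (forall a x y : CD R n,
        cddot (cdmul x a) y = cddot x (cdmul y (cdconj a))).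
Proof.
elim: n => [|n [IHl IHr]].
  split=> a x y; rewrite !cddot0E.
    by change (a * x * y = x * (a * y) :> R); ring.
  by change (x * a * y = x * (y * a) :> R); ring.
split=> a x y; rewrite !cddotS !pairE ?cdconjN ?cdconjK !cdmul_linE !cddot_linE.
  (* In the two cross terms the variable factor appears conjugated, so a single adjunction does not
     suffice: [E1] moves factors from the left and then from the right, and [E2] combines the left
     adjunction with self-adjointness of conjugation. *)
  have E1 : cddot (cdmul (cdconj x.2) a.2) y.1
      = cddot x.2 (cdmul a.2 (cdconj y.1)).
    by rewrite IHl cdconjK cddotC IHr.
  have E2 : cddot (cdmul a.2 (cdconj x.1)) y.2
      = cddot x.1 (cdmul (cdconj y.2) a.2).
    by rewrite IHl cddot_conj cdconjM cdconjK.
  rewrite (IHl a.1 x.1) (IHr a.1 x.2) E1 E2 opprK.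
  by rewrite [X in _ + X = _]addrC addrACA [X in _ + X = _]addrC.
rewrite (IHr a.1 x.1) (IHl (cdconj a.2) x.2) (IHl a.2 x.1) (IHr (cdconj a.1)).
by rewrite !cdconjK opprK addrACA.
Qed.

Lemma cddot_mull n (a x y : CD R n) :
  cddot (cdmul a x) y = cddot x (cdmul (cdconj a) y).
Proof. exact: (cddot_mul_adj n).1. Qed.

Lemma cddot_mulr n (a x y : CD R n) :
  cddot (cdmul x a) y = cddot x (cdmul y (cdconj a)).
Proof. exact: (cddot_mul_adj n).2. Qed.

(** In either order the second component cancels, and the first one adds the squared norms of the
    two halves. *)
Lemma cdmul_conj n (x : CD R n) :
  cdmul (cdconj x) x = cddot x x *: cde R n 0
  /\ cdmul x (cdconj x) = cddot x x *: cde R n 0.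
Proof.
elim: n x => [|n IH] x.
  by rewrite cddot0E; split; rewrite [RHS]mulr1.
have [I1 I2] := (IH x.1); have [J1 J2] := (IH x.2).
split; apply: cd_eqS; rewrite !pairE ?cde0_fst ?cde0_snd ?cdconjN ?cdconjK.
- by rewrite cddotS !cdmul_linE I1 J1; cdlin.
- by rewrite !cdmul_linE; cdlin.
- by rewrite cddotS !cdmul_linE I2 J1; cdlin.
by rewrite !cdmul_linE; cdlin.
Qed.

(** Polarization of the preceding norm identity. *)
Lemma cdmul_conjD n (x y : CD R n) :
  cdmul (cdconj x) y + cdmul (cdconj y) x = (2 * cddot x y) *: cde R n 0.
Proof.
have := (cdmul_conj (x + y)).1.
rewrite cdconjD !cdmul_linE (cdmul_conj x).1 (cdmul_conj y).1.
rewrite !cddot_linE (cddotC y x) => E.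
apply: cdcoord_inj => i; have /(congr1 (fun z => cdcoord z i)) := E.
by rewrite !cdcoord_linE => {}E; lra.
Qed.

(** * Pure elements *)

Lemma cdIm_conj n (x : CD R n) : cdIm x -> cdconj x = - x.
Proof.
rewrite /cdIm /= => x0.
have := cdmul_conjD x (cde R n 0).
by rewrite x0 mulr0 scale0r cdconj_e0 cdmulE0l cdmulE0r => /eqP;
  rewrite addr_eq0 => /eqP.
Qed.

Lemma conj_cdIm n (x : CD R n) : cdconj x = - x -> cdIm x.
Proof.
move=> xN; rewrite /cdIm /=.
have : cddot (cdconj x) (cde R n 0) = cddot x (cde R n 0).
  by rewrite cddot_conj cdconj_e0.
by rewrite xN cddotNl => ?; lra.
Qed.

Lemma cdIm_sqr n (x : CD R n) :
  cdIm x -> cdmul x x = - cddot x x *: cde R n 0.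
Proof.
move/cdIm_conj => xN.
by rewrite scaleNr -(cdmul_conj x).1 xN cdmulNl opprK.
Qed.

Lemma cdIm_anticomm n (x y : CD R n) :
  cdIm x -> cdIm y -> cddot x y = 0 -> cdmul y x = - cdmul x y.
Proof.
move=> /cdIm_conj xN /cdIm_conj yN xy0; have := cdmul_conjD x y.
rewrite xy0 mulr0 scale0r xN yN !cdmulNl => /eqP.
by rewrite addr_eq0 => /eqP/oppr_inj->; rewrite opprK.
Qed.

Lemma cdIm_mul n (x y : CD R n) :
  cdIm x -> cdIm y -> cddot x y = 0 -> cdIm (cdmul x y).
Proof.
move=> xI yI xy0; apply: conj_cdIm.
by rewrite cdconjM !cdIm_conj // cdmulNl cdmulNr opprK cdIm_anticomm.
Qed.

(** Since [cdconj a] is [2r e_0 - a], the norm identity becomes |a|^2 e_0 = 2r a + e_0, which is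
    then paired with e_0 and with a. *)
Lemma sqr_eqN1 n (a : CD R n) :
  cdmul a a = - cde R n 0 -> cdIm a /\ cddot a a = 1.
Proof.
set r := cddot a (cde R n 0) => aa.
have ca : cdconj a = (2 * r) *: cde R n 0 - a.
  have := cdmul_conjD a (cde R n 0).
  by rewrite cdconj_e0 cdmulE0l cdmulE0r => <-; rewrite addrK.
have na : cddot a a *: cde R n 0 = (2 * r) *: a + cde R n 0.
  by rewrite -(cdmul_conj a).1 ca !cdmul_linE cdmulE0l aa opprK.
have e1 := congr1 (fun z => cddot z (cde R n 0)) na.
have e2 := congr1 (fun z => cddot z a) na.
rewrite /= !cddot_linE cddot_e0 -/r in e1 e2; rewrite (cddotC _ a) -/r in e2.
(* The pairings read |a|^2 = 2r^2 + 1 and r |a|^2 = 2r |a|^2 + r; the second says r (|a|^2 + 1) =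
   0. *)
have r0 : r = 0 by nra.
by rewrite r0 in e1; split; [exact: r0 | lra].
Qed.

Lemma cdmul_anticomm_dot n (x y : CD R n) :
  cdIm x -> cdIm y -> cdmul y x = - cdmul x y -> cddot x y = 0.
Proof.
move=> /cdIm_conj xN /cdIm_conj yN yx; have := cdmul_conjD x y.
rewrite xN yN !cdmulNl yx opprK addNr.
move/(congr1 (fun z => cddot z (cde R n 0))).
rewrite cddotZl cddot_e0 -(scale0r (cde R n 0)) cddotZl => ?; lra.
Qed.

Lemma cdnorm_eq1 n (x : CD R n) : cdnorm x = 1 <-> cddot x x = 1.
Proof.
rewrite /cdnorm; split=> [x1 | ->]; last exact: sqrtr1.
by rewrite -(sqr_sqrtr (cddot_ge0 x)) x1 expr1n.
Qed.

Lemma cde0_neq0 n : cde R n 0 <> 0.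
Proof.
move=> e0; have := cddot_e0 n; rewrite e0 -(scale0r (0 : CD R n)) cddotZl.
by rewrite mul0r => /eqP; rewrite eq_sym oner_eq0.
Qed.

(** * Injectivity of morphisms *)

Lemma linear_map0 m n (phi : CD R m -> CD R n) : linear phi -> phi 0 = 0.
Proof.
move=> lin; have := lin 1 0 0; rewrite scaler0 addr0 scale1r => /eqP.
by rewrite -subr_eq0 opprD addNKr oppr_eq0 => /eqP.
Qed.

(* phi (x^* x) = |x|^2 e_0 vanishes only for x = 0. *)
Lemma algebra_hom_inj m n (phi : CD R m -> CD R n) :
  algebra_hom phi -> injective phi.
Proof.
case=> lin phi1 phiM x y Exy.
have phiZ k u : phi (k *: u) = k *: phi u.
  by rewrite -[k *: u]addr0 lin (linear_map0 lin) addr0.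
have xy0 : phi (x - y) = 0.
  by rewrite -[x]scale1r -[- y]scaleN1r lin phiZ Exy scale1r scaleN1r subrr.
have := (congr1 phi (cdmul_conj (x - y)).1).
rewrite phiM xy0 cdmul0r phiZ phi1 => /esym/eqP; rewrite scaler_eq0.
case/orP=> /eqP; last by move/cde0_neq0.
by move/cddot_eq0/eqP; rewrite subr_eq0 => /eqP.
Qed.

(** * Quaternions *)

(** Hamilton's product, with e_1, e_2, e_3 in the roles of i, j, k. *)
Lemma cdmul2_coord (x y : CD R 2) :
  [/\ (cdmul x y)#0 = x#0 * y#0 - x#1 * y#1 - x#2 * y#2 - x#3 * y#3,
      (cdmul x y)#1 = x#0 * y#1 + x#1 * y#0 + x#2 * y#3 - x#3 * y#2,
      (cdmul x y)#2 = x#0 * y#2 - x#1 * y#3 + x#2 * y#0 + x#3 * y#1 &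
      (cdmul x y)#3 = x#0 * y#3 + x#1 * y#2 - x#2 * y#1 + x#3 * y#0].
Proof.
case: x y => [[x0 x1] [x2 x3]] [[y0 y1] [y2 y3]].
by rewrite /=; split; ring.
Qed.

Lemma associator2 (x y z : CD R 2) : associator x y z = 0.
Proof.
case: x y z => [[x0 x1] [x2 x3]] [[y0 y1] [y2 y3]] [[z0 z1] [z2 z3]].
by apply: (@cd_eqS 1); apply: (@cd_eqS 0); rewrite /=; ring.
Qed.

(** The octonions are alternative: in each of the eight coordinates this is a polynomial identity
    over [R]. *)
Lemma alternates_strongly3 (x y : CD R 3) : alternates_strongly x y.
Proof.
case: x y => [[[x0 x1] [x2 x3]] [[x4 x5] [x6 x7]]].
case=> [[[y0 y1] [y2 y3]] [[y4 y5] [y6 y7]]].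
by split; apply: (@cd_eqS 2); apply: (@cd_eqS 1); apply: (@cd_eqS 0);
  rewrite /=; ring.
Qed.

Lemma cde2_mul :
  [/\ cdmul (cde R 2 1) (cde R 2 1) = - cde R 2 0,
      cdmul (cde R 2 2) (cde R 2 2) = - cde R 2 0,
      cdmul (cde R 2 1) (cde R 2 2) = cde R 2 3 &
      cdmul (cde R 2 2) (cde R 2 1) = - cde R 2 3].
Proof.
by split; apply: (@cd_eqS 1); apply: (@cd_eqS 0); rewrite /=; ring.
Qed.

(** Nesting to the right with a final 0 gives the shape [k *: u + v], to which [linear phi] applies
    repeatedly. *)
Lemma cd2_coordE (x : CD R 2) :
  x = x#0 *: cde R 2 0 + (x#1 *: cde R 2 1
    + (x#2 *: cde R 2 2 + (x#3 *: cde R 2 3 + 0))).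
Proof. by rewrite {1}(cd_coordE x) !big_ord_recl big_ord0. Qed.

(** The only possible morphism sending e_1, e_2 to [a], [b], as e_3 = e_1 e_2. *)
Definition quat_ext n (a b : CD R n) (x : CD R 2) : CD R n :=
  x#0 *: cde R n 0 + x#1 *: a + x#2 *: b + x#3 *: cdmul a b.

Lemma quat_ext_hom n (a b : CD R n) :
  Stiefel2 R n (a, b) -> alternates_strongly a b -> algebra_hom (quat_ext a b).
Proof.
case=> /= aI bI ab0 /cdnorm_eq1 aa1 /cdnorm_eq1 bb1 [/eqP + /eqP].
rewrite !subr_eq0 => /eqP aab /eqP abb.
have aa : cdmul a a = - cde R n 0 by rewrite cdIm_sqr // aa1 scaleN1r.
have bb : cdmul b b = - cde R n 0 by rewrite cdIm_sqr // bb1 scaleN1r.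
have ba := cdIm_anticomm aI bI ab0; have cI := cdIm_mul aI bI ab0.
have ac : cdmul a (cdmul a b) = - b by rewrite -aab aa cdmulNl cdmulE0l.
have cb : cdmul (cdmul a b) b = - a by rewrite abb bb cdmulNr cdmulE0r.
(* By adjunction |ab|^2 = <a, (ab)b^*> = - <a, (ab)b> = |a|^2. *)
have cc1 : cddot (cdmul a b) (cdmul a b) = 1.
  by rewrite cddot_mulr cdIm_conj // cdmulNr cb opprK.
(* [ab] anticommutes with [a], because <ab, a> = <b, a^* a> = <b, e_0> = 0; the argument for [b]
   below is symmetric. *)
have ca : cdmul (cdmul a b) a = b.
  rewrite (cdIm_anticomm aI cI) ?ac ?opprK //.
  by rewrite cddotC cddot_mull (cdIm_conj aI) cdmulNl aa opprK.
move/cdIm_sqr: (cI); rewrite cc1 scaleN1r => cc.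
have bc : cdmul b (cdmul a b) = a.
  rewrite (cdIm_anticomm cI bI) ?cb ?opprK //.
  by rewrite cddot_mulr (cdmul_conj b).2 bb1 scale1r.
split.
- move=> k x y; rewrite /quat_ext !cdcoord_linE; cdlin.
- by rewrite /quat_ext /= !(scale0r, scale1r, addr0).
- move=> x y; have [x0 x1 x2 x3] := cdmul2_coord x y.
  rewrite /quat_ext x0 x1 x2 x3.
  (* With [ab] abstracted to an atom [c], bilinear expansion leaves only products of e_0, [a], [b],
     [c], all given by the table. *)
  move: ac cb ca cc bc ba; move ab: (cdmul a b) => c ac cb ca cc bc ba.
  rewrite !cdmul_linE !cdmulE0l !cdmulE0r.
  rewrite aa bb ab ba ac ca bc cb cc; cdlin.
Qed.

Lemma ev12_bij n :
  set_bij (Mono R 2 n) [set p | Stiefel2 R n p /\ alternates_strongly p.1 p.2]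
    (@ev12 R n).
Proof.
have [m11 m22 m12 m21] := cde2_mul; split.
- move=> phi [[lin phi1 phiM] _].
  have phi0 := linear_map0 lin.
  have phiN u : phi (- u) = - phi u.
    by rewrite -scaleN1r -[_ *: _]addr0 lin phi0 addr0 scaleN1r.
  (* The image inherits associativity from A_2; this yields strong alternation. *)
  have phiA u v w : associator (phi u) (phi v) (phi w) = 0.
    by apply/eqP; rewrite subr_eq0 -!phiM; apply/eqP; congr phi;
      apply/eqP; rewrite -subr_eq0 -/(associator u v w) associator2.
  have /sqr_eqN1 [aI aa] :
      cdmul (phi (cde R 2 1)) (phi (cde R 2 1)) = - cde R n 0.
    by rewrite -phiM m11 phiN phi1.
  have /sqr_eqN1 [bI bb] :
      cdmul (phi (cde R 2 2)) (phi (cde R 2 2)) = - cde R n 0.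
    by rewrite -phiM m22 phiN phi1.
  split=> //; split=> //=; try by apply/cdnorm_eq1.
  by apply: cdmul_anticomm_dot; rewrite // -!phiM m12 m21 phiN.
- move=> phi psi /set_mem [[lin phi1 phiM] _] /set_mem [[lin' psi1 psiM] _].
  case=> E1 E2; apply/funext => x.
  have phi0 := linear_map0 lin.
  have psi0 := linear_map0 lin'.
  (* Once e_3 is written as e_1 e_2, only values at e_0, e_1, e_2 remain, where both morphisms
     agree. *)
  rewrite (cd2_coordE x) -m12 !lin !lin' phi0 psi0.
  by rewrite phi1 psi1 phiM psiM E1 E2.
- move=> [a b] [ab_st ab_alt]; exists (quat_ext a b).
    have qh := quat_ext_hom ab_st ab_alt.
    by split=> //; apply: algebra_hom_inj qh.
  rewrite /ev12 /quat_ext /=; congr (_, _);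
  by rewrite !(scale0r, scale1r, addr0, add0r).
Qed.

(** An injective endomorphism of a finite-dimensional space is bijective. *)
Lemma Aut2E : Aut R 2 = Mono R 2 2.
Proof.
apply/seteqP; split=> phi [phiH phiB]; split=> //; first exact: bij_inj.
case: phiH => lin _ _.
pose V := ((R^o * R^o) * (R^o * R^o))%type : vectType R.
(* [V] gives the carrier of [CD R 2] its [vectType] structure, so that [phi] becomes a [linfun] with
   trivial kernel and has an inverse. *)
pose lphi := GRing.isLinear.Build R (CD R 2) (CD R 2) *:%R phi lin.
pose f : {linear V -> V} := HB.pack (phi : V -> V) lphi.
have kf : lker (linfun f) == 0%VS.
  by apply/lker0P => u v; rewrite !lfunE; apply: phiB.
exists ((linfun f)^-1)%VF => x.
  by rewrite -[phi x](lfunE f x) lker0_lfunK.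
by rewrite -[RHS](lker0_lfunVK kf) lfunE.
Qed.

(** * Identification with SO(3) *)

Definition mx33 (a b c d e f g h k : R) : 'M[R]_3 :=
  \matrix_(i < 3, j < 3)
    nth 0 (nth [::] [:: [:: a; b; c]; [:: d; e; f]; [:: g; h; k]] i) j.

Lemma mx33_eta (A : 'M[R]_3) :
  let a (i j : nat) := A (inord i) (inord j) in
  A = mx33 (a 0 0)%N (a 0 1)%N (a 0 2)%N
           (a 1 0)%N (a 1 1)%N (a 1 2)%N
           (a 2 0)%N (a 2 1)%N (a 2 2)%N.
Proof.
apply/matrixP => i j; rewrite mxE -{1}(inord_val i) -{1}(inord_val j).
by case: i j => [[|[|[|i]]]] // ? [[|[|[|j]]]].
Qed.

Lemma mx33_inj a b c d e f g h k a' b' c' d' e' f' g' h' k' :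
  mx33 a b c d e f g h k = mx33 a' b' c' d' e' f' g' h' k' ->
  [/\ [/\ a = a', b = b' & c = c'], [/\ d = d', e = e' & f = f']
    & [/\ g = g', h = h' & k = k']].
Proof.
move/matrixP => E.
have {}E i j := E (inord i) (inord j).
by split; split; [move: (E 0 0)%N | move: (E 0 1)%N | move: (E 0 2)%N
  | move: (E 1 0)%N | move: (E 1 1)%N | move: (E 1 2)%N
  | move: (E 2 0)%N | move: (E 2 1)%N | move: (E 2 2)%N]; rewrite !mxE !inordK.
Qed.

Lemma mx33_1 : 1%:M = mx33 1 0 0 0 1 0 0 0 1.
Proof.
apply/matrixP => i j; rewrite !mxE.
by case: i j => [[|[|[|i]]]] // ? [[|[|[|j]]]].
Qed.

Lemma mx33_gram a b c d e f g h k : let A := mx33 a b c d e f g h k in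
  A^T *m A = mx33 (a * a + d * d + g * g) (a * b + d * e + g * h)
                  (a * c + d * f + g * k)
                  (b * a + e * d + h * g) (b * b + e * e + h * h)
                  (b * c + e * f + h * k)
                  (c * a + f * d + k * g) (c * b + f * e + k * h)
                  (c * c + f * f + k * k).
Proof.
apply/matrixP => i j; rewrite mxE !big_ord_recl big_ord0 !mxE.
by case: i j => [[|[|[|i]]]] // ? [[|[|[|j]]]] //= ?; rewrite addr0 addrA.
Qed.

Lemma mx33_det a b c d e f g h k : \det (mx33 a b c d e f g h k)
  = a * (e * k - f * h) - b * (d * k - f * g) + c * (d * h - e * g).
Proof.
rewrite (expand_det_row _ 0) !big_ord_recl big_ord0 /cofactor.
rewrite !(expand_det_row _ 0) !big_ord_recl !big_ord0 /cofactor !det_mx11.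
by rewrite !mxE /= /bump /=; ring.
Qed.

Lemma frame_mxE (u v : CD R 2) :
  frame_mx (u, v) = mx33 u#1 v#1 (u#2 * v#3 - u#3 * v#2)
                         u#2 v#2 (u#3 * v#1 - u#1 * v#3)
                         u#3 v#3 (u#1 * v#2 - u#2 * v#1).
Proof.
apply/matrixP => i j; rewrite /frame_mx [RHS]mxE.
case: j => [[|[|[|j]]]] // Hj.
(* The columns form blocks 1 + (1 + 1), so each index is rewritten as a shift into its block. *)
- rewrite (_ : Ordinal Hj = @lshift 1 2 0); last exact: val_inj.
  apply: etrans (row_mxEl _ _ i 0) _; rewrite mxE.
  by case: i => [[|[|[|i]]]].
- rewrite (_ : Ordinal Hj = @rshift 1 2 (@lshift 1 1 0)); last exact: val_inj.
  apply: etrans (row_mxEr _ _ i (@lshift 1 1 0)) _; rewrite row_mxEl mxE.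
  by case: i => [[|[|[|i]]]].
rewrite (_ : Ordinal Hj = @rshift 1 2 (@rshift 1 1 0)); last exact: val_inj.
apply: etrans (row_mxEr _ _ i (@rshift 1 1 0)) _; rewrite row_mxEr !mxE.
by case: i => [[|[|[|i]]]].
Qed.

Lemma cddot2E (x y : CD R 2) :
  cddot x y = x#0 * y#0 + x#1 * y#1 + x#2 * y#2 + x#3 * y#3.
Proof. by rewrite /cddot !big_ord_recl big_ord0 addr0 !addrA. Qed.

Lemma Stiefel2_coord (x y : CD R 2) : Stiefel2 R 2 (x, y) <->
  [/\ x#0 = 0, y#0 = 0,
      x#1 * y#1 + x#2 * y#2 + x#3 * y#3 = 0,
      x#1 * x#1 + x#2 * x#2 + x#3 * x#3 = 1 &
      y#1 * y#1 + y#2 * y#2 + y#3 * y#3 = 1].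
Proof.
have E (z : CD R 2) : cdIm z = (z#0 = 0).
  rewrite /cdIm -[LHS]/(cddot z (cde R 2 0) = 0) cddot2E.
  by rewrite !cdcoordE // !(mulr0, mulr1, addr0).
rewrite -[X in X <-> _]/([/\ cdIm x, cdIm y, cddot x y = 0, cdnorm x = 1
  & cdnorm y = 1]) !E !(propext (cdnorm_eq1 _)) !cddot2E.
by split=> -[x0 y0]; rewrite x0 y0 !mul0r !add0r.
Qed.

Lemma frame_mx_bij : set_bij (Stiefel2 R 2) (SO3 R) (@frame_mx R).
Proof.
split.
- move=> [u v] /Stiefel2_coord [_ _ uv uu vv]; rewrite /SO3 /= frame_mxE.
  rewrite mx33_gram mx33_det mx33_1.
  (* Lagrange's identity |u x v|^2 = |u|^2 |v|^2 - <u, v>^2. The determinant of the frame is this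
     same quantity. *)
  have ww : (u#2 * v#3 - u#3 * v#2) ^+ 2 + (u#3 * v#1 - u#1 * v#3) ^+ 2
      + (u#1 * v#2 - u#2 * v#1) ^+ 2 = 1.
    transitivity ((u#1 * u#1 + u#2 * u#2 + u#3 * u#3)
        * (v#1 * v#1 + v#2 * v#2 + v#3 * v#3)
      - (u#1 * v#1 + u#2 * v#2 + u#3 * v#3) ^+ 2); first by ring.
    by rewrite uu vv uv; ring.
  split; last by rewrite -ww; ring.
  by congr mx33; rewrite ?uu ?vv ?uv -?ww; try ring; rewrite -uv; ring.
- move=> [u v] [u' v'] /set_mem /Stiefel2_coord [u0 v0 _ _ _].
  move=> /set_mem /Stiefel2_coord [u0' v0' _ _ _].
  rewrite !frame_mxE => /mx33_inj [[u1 v1 _] [u2 v2 _] [u3 v3 _]].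
  by rewrite (cd2_coordE u) (cd2_coordE u') (cd2_coordE v) (cd2_coordE v')
    u0 u1 u2 u3 v0 v1 v2 v3 u0' v0'.
move=> A; rewrite (mx33_eta A) /SO3 /=.
(* The rightmost pattern is generalized first and catches the first entry, hence the reversed order
   of names. *)
move: (A _ _) (A _ _) (A _ _) (A _ _) (A _ _) (A _ _) (A _ _) (A _ _) (A _ _).
move=> k h g f e d c b a.
rewrite mx33_gram mx33_det mx33_1.
case=> /mx33_inj [[uu uv uw] [_ vv vw] [_ _ ww]] detA.
(* The first two columns, read as pure quaternions; it remains to see that the third column is their
   cross product. *)
pose u : CD R 2 := ((0, a), (d, g)); pose v : CD R 2 := ((0, b), (e, h)).
exists (u, v); first by apply/Stiefel2_coord; split.
rewrite frame_mxE /=.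
(* |w - u x v|^2 = |w|^2 - 2 det (u, v, w) + |u|^2 |v|^2 - (u, v)^2 = 0 *)
have /eqP : (c - (d * h - g * e)) ^+ 2 + (f - (g * b - a * h)) ^+ 2
    + (k - (a * e - d * b)) ^+ 2 = 0.
  transitivity ((c * c + f * f + k * k)
    - 2 * (a * (e * k - f * h) - b * (d * k - f * g) + c * (d * h - e * g))
    + (a * a + d * d + g * g) * (b * b + e * e + h * h)
    - (a * b + d * e + g * h) ^+ 2); first by ring.
  by rewrite ww detA uu vv uv; ring.
rewrite !paddr_eq0 ?addr_ge0 ?sqr_ge0 // !sqrf_eq0 !subr_eq0.
by case/andP=> [/andP[/eqP-> /eqP->] /eqP->].
Qed.

End CayleyDicksonTheory.

Theorem proposition2p3 (R : realType) :
  (forall n : nat, (2 <= n)%N ->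
     set_bij (Mono R 2 n)
       [set p | Stiefel2 R n p /\ alternates_strongly p.1 p.2]
       (@ev12 R n))
  /\ (Aut R 2 = Mono R 2 2
      /\ set_bij (Mono R 2 2) (Stiefel2 R 2) (@ev12 R 2)
      /\ set_bij (Stiefel2 R 2) (SO3 R) (@frame_mx R))
  /\ set_bij (Mono R 2 3) (Stiefel2 R 3) (@ev12 R 3).
Proof.
(* Used for A_2, which is associative, and for A_3, which is alternative: there the target is the
   whole Stiefel manifold. *)
have alt_all n : (forall a b : CD R n, alternates_strongly a b) ->
    [set p | Stiefel2 R n p /\ alternates_strongly p.1 p.2] = Stiefel2 R n.
  by move=> alt; apply/seteqP; split=> p; [case | split].
split; first by move=> n _; exact: ev12_bij.
split; last first.
  by rewrite -(alt_all _ (@alternates_strongly3 R)); apply: ev12_bij.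
split; [exact: Aut2E | split; last exact: frame_mx_bij].
rewrite -alt_all; first exact: ev12_bij.
by move=> a b; split; apply: associator2.
Qed.
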